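(* Let $A\geq a\geq 1$ and $r\geq 1$ be integers. For $n\geq 0$ let $\sigma mes_{r,A,a}(n)=\sum_{\pi\in\overline{\mathcal{P}}(n)}mes_{r,A,a}(\pi)$. Then \[ \sum_{n=0}^\infty\sigma mes_{r,A,a}(n)q^n =\frac{(-q;q)_{\infty}}{(q;q)_{\infty}}\bigg[a+A\sum_{k=1}^{\infty}\frac{2^kq^{r[A\binom{k}{2}+ka]}}{(-q^a;q^A)_k}\bigg]. \]
   Context: An overpartition is a partition (finite non-increasing sequence of positive integers) in which the first occurrence of each part value may be overlined; $\overline{\mathcal{P}}(n)$ denotes the set of overpartitions of $n$ (the sum of parts is $n$). A part is of size $t$ if it equals $t$ or $\overline{t}$. $(a;q)_\infty=\prod_{i\geq0}(1-aq^i)$ and $(a;q)_n=(a;q)_\infty/(aq^n;q)_\infty$; $|q|<1$. For $r\geq1$, $mes_{r,A,a}(\pi)$ is the smallest positive integer $\equiv a\pmod A$ such that there are fewer than $r$ parts of size $mes_{r,A,a}(\pi)$ in $\pi$. *)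

(* Defs.v *)
From HB Require Import structures.
From mathcomp Require Import all_boot all_order all_algebra complex.
From mathcomp Require Import all_classical all_reals all_analysis.

Set Implicit Arguments.
Unset Strict Implicit.
Unset Printing Implicit Defensive.

Import Order.TTheory GRing.Theory Num.Theory numFieldNormedType.Exports.

Local Open Scope classical_set_scope.
Local Open Scope ring_scope.

(* A part is a pair (size, overlined?). *)
Definition part : Type := (nat * bool)%type.
Definition part_sizes (pi : seq part) : seq nat := [seq p.1 | p <- pi].

(* The [pairwise] clause allows only the first occurrence of each size to be
   overlined: an overlined part is preceded by no part of the same size. *)
Definition is_overpartition (pi : seq part) : bool :=
  [&& all (fun t => (0 < t)%N) (part_sizes pi),
      sorted geq (part_sizes pi)
    & pairwise (fun p p' : part => p'.2 ==> (p.1 != p'.1)) pi].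

Definition overpartitions (n : nat) : set (seq part) :=
  [set pi | is_overpartition pi /\ sumn (part_sizes pi) = n].

Definition num_parts (t : nat) (pi : seq part) : nat :=
  count_mem t (part_sizes pi).

Definition mes_candidate (r A a : nat) (pi : seq part) (m : nat) : bool :=
  [&& (0 < m)%N, m == a %[mod A] & (num_parts m pi < r)%N].

(* The default value 0 is irrelevant when 0 < A and 0 < r: see [mesP]. *)
Definition mes (r A a : nat) (pi : seq part) : nat :=
  if pselect (exists m, mes_candidate r A a pi m) is left ex
  then ex_minn ex else 0%N.

(* A genuine finite sum: see [finite_overpartitions]. *)
Definition sigma_mes (r A a n : nat) : nat :=
  (\big[addn/0%N]_(pi \in overpartitions n) mes r A a pi)%N.

Definition qpoch_inf (K : numFieldType) (x q : K) : K :=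
  limn (fun n => \prod_(0 <= i < n) (1 - x * q ^+ i)).

Definition qpoch (K : numFieldType) (x q : K) (n : nat) : K :=
  qpoch_inf x q / qpoch_inf (x * q ^+ n) q.

(* R[i] packed as a numFieldType, so as to get the topology induced by the
   modulus. *)
Definition complexes (R : realType) : numFieldType := R[i].

Lemma mes_exists r A a pi : (0 < A)%N -> (0 < r)%N ->
  exists m, mes_candidate r A a pi m.
Proof.
move=> A0 r0; pose N := sumn (part_sizes pi).
exists (a + N.+1 * A)%N; rewrite /mes_candidate; apply/and3P; split.
- by rewrite addn_gt0 muln_gt0 /= A0 orbT.
- by rewrite addnC modnMDl.
- apply: leq_trans r0; rewrite ltnS leqn0; apply/eqP/count_memPn/negP => Hin.
  have : (a + N.+1 * A <= N)%N.
    rewrite {2}/N; elim: (part_sizes pi) Hin => //= t s IH.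
    rewrite inE => /orP[/eqP <-|/IH h]; first exact: leq_addr.
    by apply: leq_trans h _; exact: leq_addl.
  rewrite leqNgt => /negP; apply; apply: leq_trans (leq_addl _ _).
  by rewrite leq_pmulr.
Qed.

Lemma mesP r A a pi : (0 < A)%N -> (0 < r)%N ->
  mes_candidate r A a pi (mes r A a pi) /\
  forall m, mes_candidate r A a pi m -> (mes r A a pi <= m)%N.
Proof.
move=> A0 r0; rewrite /mes; case: pselect => [ex|[]]; last exact: mes_exists.
by case: ex_minnP.
Qed.

Lemma finite_overpartitions n : finite_set (overpartitions n).
Proof.
pose f (s : {bseq n of 'I_n.+1 * bool}) : seq part :=
  [seq (val p.1, p.2) | p <- s].
apply: (@sub_finite_set _ _ (f @` [set: {bseq n of 'I_n.+1 * bool}])); last first.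
  by apply: finite_image; exact: finite_finset.
move=> pi [] /and3P[pos _ _] sn.
have szn : (size pi <= n)%N.
  rewrite -sn; elim: pi pos {sn} => //= p pi IH /andP[p0 /IH h].
  by rewrite -add1n leq_add.
have len : forall p, p \in pi -> (p.1 < n.+1)%N.
  rewrite -sn => p; elim: pi {pos szn sn} => //= p' pi IH.
  rewrite inE => /orP[/eqP ->|/IH h]; first by rewrite ltnS leq_addr.
  by apply: leq_trans h _; rewrite ltnS leq_addl.
pose g (p : part) : 'I_n.+1 * bool := (inord p.1, p.2).
have szg : (size [seq g p | p <- pi] <= n)%N by rewrite size_map.
exists (Bseq szg) => //; rewrite /f /= -map_comp -[RHS]map_id.
by apply/eq_in_map => -[t b] /len /= tn; rewrite /g /= inordK.
Qed.

(* Main.v *)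
Require Import Defs.
From HB Require Import structures.
From mathcomp Require Import all_boot all_order all_algebra complex.
From mathcomp Require Import all_classical all_reals all_analysis.
From mathcomp Require Import zify ring.

(** The sizes congruent to [a] modulo [A] are [t_j = a + j * A], so [mes pi] is
    [a + A * #{k >= 1 | t_0, ..., t_(k-1) all occur at least r times in pi}].
    In the generating function of overpartitions a size [t] contributes
    [(1 + q^t) / (1 - q^t)], and [2 q^(r t) / (1 - q^t)] when it must occur at
    least [r] times; the quotients [2 q^(r t_j) / (1 + q^t_j)] multiply up to
    the [k]-th term of the series.

    For convergence, the overpartitions with parts at most [N] and
    multiplicities at most [M] are finitely many, and their generating function
    factors exactly.  Letting [M] and then [N = a + L * A] tend to infinity
    gives the right-hand side.  The truncation differs from the [L]-th partial
    sum of the left-hand series by at most the corresponding difference at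
    [|q|], and the partial sums at [|q|] are bounded because the right-hand
    side converges there too. *)

Set Implicit Arguments.
Unset Strict Implicit.
Unset Printing Implicit Defensive.

Import Order.TTheory GRing.Theory Num.Theory numFieldNormedType.Exports.
Import ComplexField.Normc.

Local Open Scope classical_set_scope.
Local Open Scope ring_scope.

(** * Overpartitions with bounded parts and multiplicities *)

Definition weight (pi : seq part) : nat := sumn (part_sizes pi).

Definition parts_le (N : nat) (pi : seq part) : bool :=
  all (fun p => p.1 <= N)%N pi.

Definition part_ge (p p' : part) : bool :=
  (p'.1 <= p.1)%N && (p'.2 ==> (p.1 != p'.1)).

(* [c] is a multiplicity and an overlining flag for the first part; the flag is
   ignored when the multiplicity is 0. *)
Definition block (t : nat) (c : nat * bool) : seq part :=
  if c.1 is m.+1 then (t, c.2) :: nseq m (t, false) else [::].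

Lemma is_overpartitionE pi :
  is_overpartition pi = all (fun p => 0 < p.1)%N pi && pairwise part_ge pi.
Proof.
rewrite /is_overpartition /part_sizes all_map sorted_pairwise; last first.
  by move=> x y z /= yx xz; apply: leq_trans xz yx.
rewrite pairwise_map; congr (_ && _).
elim: pi => //= p pi <-; rewrite [all (part_ge p) _]all_predI /relpre /=.
by rewrite -!andbA; congr (_ && _); rewrite andbCA.
Qed.

Lemma is_overpartition_cat pi pi' : is_overpartition (pi ++ pi') =
  [&& is_overpartition pi, is_overpartition pi' & allrel part_ge pi pi'].
Proof.
rewrite !is_overpartitionE all_cat pairwise_cat.
by case: all; case: all; case: allrel; case: pairwise; case: pairwise.
Qed.

Lemma part_sizes_block t c : part_sizes (block t c) = nseq c.1 t.
Proof. by case: c => -[|m] b //=; rewrite /part_sizes map_nseq. Qed.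

Lemma size_block t c : size (block t c) = c.1.
Proof. by rewrite -(size_map fst) -/(part_sizes _) part_sizes_block size_nseq. Qed.

Lemma mem_block t c p : p \in block t c -> p.1 = t.
Proof.
by move=> /(map_f fst); rewrite -/(part_sizes _) part_sizes_block => /nseqP[].
Qed.

Lemma block_inj t : {in [pred c | c.2 ==> (0 < c.1)%N] &, injective (block t)}.
Proof.
move=> [m b] [m' b']; rewrite !inE /= => mb mb' eq_block.
have eq_m : m = m' by have := congr1 size eq_block; rewrite !size_block.
by subst m'; case: m mb mb' eq_block => [|m]; case: b; case: b'.
Qed.

Lemma is_overpartition_block t c : (0 < t)%N -> is_overpartition (block t c).
Proof.
move=> t0; rewrite is_overpartitionE; case: c => -[|m] b //=.
rewrite t0 !all_nseq /part_ge /= leqnn t0 !orbT /=.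
by elim: m => //= m ->; rewrite all_nseq /part_ge /= leqnn orbT.
Qed.

Lemma num_parts_cat_block t s c pi :
  num_parts s (block t c ++ pi) = ((t == s) * c.1 + num_parts s pi)%N.
Proof.
rewrite /num_parts /part_sizes map_cat count_cat -/(part_sizes _).
by rewrite part_sizes_block count_nseq.
Qed.

Lemma parts_leW N N' pi : (N <= N')%N -> parts_le N pi -> parts_le N' pi.
Proof. by move=> NN'; apply: sub_all => p /leq_trans; apply. Qed.

Lemma num_parts_eq0 N pi t : parts_le N pi -> (N < t)%N -> num_parts t pi = 0%N.
Proof.
move=> /allP le_N Nt; apply/count_memPn/negP => /mapP[p /le_N pN tp].
by rewrite tp ltnNge pN in Nt.
Qed.

Lemma overpartition_cat_block N c pi : is_overpartition pi -> parts_le N pi ->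
  is_overpartition (block N.+1 c ++ pi) /\ parts_le N.+1 (block N.+1 c ++ pi).
Proof.
move=> op le_N; split; last first.
  rewrite /parts_le all_cat -/(parts_le _ pi) (parts_leW (leqnSn N)) // andbT.
  by apply/allP => p /mem_block ->.
rewrite is_overpartition_cat is_overpartition_block // op /=.
apply/allrelP => p p' /mem_block pN /(allP le_N) p'N.
by rewrite /part_ge pN leqW //= gtn_eqF ?implybT.
Qed.

Lemma overpartition_split_block N pi : is_overpartition pi -> parts_le N.+1 pi ->
  exists c pi', [/\ pi = block N.+1 c ++ pi', c.2 ==> (0 < c.1)%N,
    is_overpartition pi' & parts_le N pi'].
Proof.
elim: pi => [|p pi IH] op; rewrite {1}/parts_le /=; first by exists (0%N, false), [::].
move: (op); rewrite is_overpartitionE /= => /andP[/andP[p0 pos] /andP[p_ge ge]].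
have [pN _|Np /andP[pN le_N]] := leqP p.1 N.
  exists (0%N, false), (p :: pi); split => //=; rewrite /parts_le /= pN /=.
  by apply: sub_all p_ge => p' /andP[/leq_trans le_p _]; apply: le_p.
have {Np pN}pE : p = (N.+1, p.2).
  by rewrite [LHS]surjective_pairing; congr pair; apply/eqP; rewrite eqn_leq pN Np.
have [|//|[m b] [pi' [piE mb op' le_N']]] := IH; first by rewrite is_overpartitionE pos.
have b0 : b = false.
  apply/negP => b1; case: m mb piE => [|m _ piE]; first by rewrite b1.
  by move: p_ge; rewrite piE pE /= /part_ge b1 /= eqxx andbF.
exists (m.+1, p.2), pi'; split; rewrite ?implybT //.
by rewrite piE [in LHS]pE b0; case: (m).
Qed.

Definition multiplicities (M : nat) : seq (nat * bool) :=
  [seq (m, false) | m <- index_iota 0 M.+1] ++ [seq (m, true) | m <- index_iota 1 M.+1].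

Fixpoint bounded_overpartitions (M N : nat) : seq (seq part) :=
  if N is N'.+1 then
    [seq block N c ++ pi | c <- multiplicities M,
                           pi <- bounded_overpartitions M N']
  else [:: [::]].

Lemma mem_multiplicities M c :
  (c \in multiplicities M) = (c.1 <= M)%N && (c.2 ==> (0 < c.1)%N).
Proof.
have mem_pair (b : bool) s : (c \in [seq (m, b) | m <- s]) = (c.1 \in s) && (c.2 == b).
  apply/mapP/andP => [[m ms ->] //|[cs /eqP <-]]; exists c.1 => //.
  exact: surjective_pairing.
rewrite mem_cat !mem_pair !mem_index_iota !ltnS.
by case: c.2; rewrite /= ?andbT ?andbF ?orbF // andbC.
Qed.

Lemma uniq_multiplicities M : uniq (multiplicities M).
Proof.
rewrite cat_uniq !map_inj_uniq ?iota_uniq => [|? ? []|? ? []] //; rewrite andbT.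
by apply/hasPn => _ /mapP[m _ ->]; apply/negP => /mapP[].
Qed.

Lemma bounded_overpartitionsP M N pi :
  reflect [/\ is_overpartition pi, parts_le N pi
             & forall t, (num_parts t pi <= M)%N]
          (pi \in bounded_overpartitions M N).
Proof.
apply/(iffP idP); elim: N pi => [|N IH] pi.
- by rewrite inE => /eqP ->.
- case/allpairsP => -[c pi'] /= [+ /IH[op le_N le_M] ->].
  rewrite mem_multiplicities => /andP[cM _].
  have [op' le_N'] := overpartition_cat_block c op le_N; split => // t.
  rewrite num_parts_cat_block; case: eqP => [<-|_]; last by rewrite mul0n add0n.
  by rewrite (num_parts_eq0 le_N) // mul1n addn0.
- case: pi => // p pi [+ /andP[p0 _] _]; rewrite is_overpartitionE /=.
  by case/andP => /andP[]; rewrite ltnNge p0.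
- case=> op le_N le_M.
  have [c [pi' [piE c0 op' le_N']]] := overpartition_split_block op le_N.
  rewrite piE; apply/allpairsP; exists (c, pi'); split => //=.
    rewrite mem_multiplicities c0 andbT; apply: leq_trans (le_M N.+1).
    by rewrite piE num_parts_cat_block eqxx mul1n leq_addr.
  apply: IH; split => // t; apply: leq_trans (le_M t).
  by rewrite piE num_parts_cat_block leq_addl.
Qed.

Lemma uniq_bounded_overpartitions M N : uniq (bounded_overpartitions M N).
Proof.
elim: N => // N IH; apply: allpairs_uniq => //; first exact: uniq_multiplicities.
move=> _ _ /allpairsP[[c pi] [cM piN ->]] /allpairsP[[c' pi'] [cM' piN' ->]] /= eq_cat.
have valid d : d \in multiplicities M -> d.2 ==> (0 < d.1)%N.
  by rewrite mem_multiplicities => /andP[].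
have num0 rho : rho \in bounded_overpartitions M N -> num_parts N.+1 rho = 0%N.
  by case/bounded_overpartitionsP => _ /num_parts_eq0 ->.
have eq_size : size (block N.+1 c) = size (block N.+1 c').
  have := congr1 (num_parts N.+1) eq_cat.
  by rewrite !num_parts_cat_block eqxx !num0 // !mul1n !addn0 !size_block.
move/eqP: eq_cat; rewrite eqseq_cat // => /andP[/eqP/block_inj eq_c /eqP ->].
by rewrite eq_c ?inE ?valid.
Qed.

Lemma part_size_le_weight p pi : p \in pi -> (p.1 <= weight pi)%N.
Proof.
by move=> /(map_f fst) p_in; rewrite /weight sumnE (big_rem p.1) // leq_addr.
Qed.

Lemma size_le_weight pi : is_overpartition pi -> (size pi <= weight pi)%N.
Proof.
case/and3P => pos _ _; rewrite -(size_map fst) -/(part_sizes pi) /weight.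
elim: (part_sizes pi) pos => //= t s IH /andP[t0 /IH].
by rewrite -add1n; apply: leq_add.
Qed.

Lemma overpartition_bounded M N pi :
    is_overpartition pi -> (weight pi <= M)%N -> (weight pi <= N)%N ->
  pi \in bounded_overpartitions M N.
Proof.
move=> op leM leN; apply/bounded_overpartitionsP; split => //.
  by apply/allP => p /part_size_le_weight/leq_trans; apply.
move=> t; apply: leq_trans leM; apply: leq_trans (size_le_weight op).
by rewrite -(size_map fst); apply: count_size.
Qed.

Lemma bounded_overpartitions_sub M M' N N' : (M <= M')%N -> (N <= N')%N ->
  {subset bounded_overpartitions M N <= bounded_overpartitions M' N'}.
Proof.
move=> MM' NN' pi /bounded_overpartitionsP[op le_N le_M].
apply/bounded_overpartitionsP; split => //; first exact: parts_leW le_N.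
by move=> t; apply: leq_trans (le_M t) MM'.
Qed.

(** * Generating functions over bounded overpartitions *)

Definition bounded_gf (K : pzSemiRingType) (w : seq part -> nat) (M N : nat)
    (y : K) : K :=
  \sum_(pi <- bounded_overpartitions M N) (w pi)%:R * y ^+ weight pi.

Definition overpartition_sum (w : seq part -> nat) (n : nat) : nat :=
  (\big[addn/0%N]_(pi \in overpartitions n) w pi)%N.

Definition partial_gf (K : pzSemiRingType) (w : seq part -> nat) (L : nat)
    (y : K) : K :=
  \sum_(0 <= n < L) (overpartition_sum w n)%:R * y ^+ n.

Lemma rmorph_bounded_gf (K K' : pzSemiRingType) (f : {rmorphism K -> K'}) w M N y :
  f (bounded_gf w M N y) = bounded_gf w M N (f y).
Proof.
by rewrite rmorph_sum; apply: eq_bigr => pi _; rewrite rmorphM rmorph_nat rmorphXn.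
Qed.

Lemma rmorph_partial_gf (K K' : pzSemiRingType) (f : {rmorphism K -> K'}) w L y :
  f (partial_gf w L y) = partial_gf w L (f y).
Proof.
by rewrite rmorph_sum; apply: eq_bigr => n _; rewrite rmorphM rmorph_nat rmorphXn.
Qed.

Lemma overpartition_sumE w n M N : (n <= M)%N -> (n <= N)%N ->
  overpartition_sum w n =
  (\sum_(pi <- bounded_overpartitions M N | weight pi == n) w pi)%N.
Proof.
move=> nM nN; rewrite -big_filter fsbig_seq; last first.
  by rewrite filter_uniq ?uniq_bounded_overpartitions.
congr (\big[_/_]_(_ \in _) _); apply/seteqP; split => pi /=; rewrite mem_filter.
  by case=> op weight_pi; rewrite overpartition_bounded /weight ?weight_pi ?eqxx.
by case/andP => /eqP <- /bounded_overpartitionsP[].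
Qed.

Lemma partial_gfE (K : pzSemiRingType) w L M N (y : K) : (L <= M)%N -> (L <= N)%N ->
  partial_gf w L y =
  \sum_(pi <- bounded_overpartitions M N | (weight pi < L)%N)
    (w pi)%:R * y ^+ weight pi.
Proof.
move=> LM LN; rewrite /partial_gf.
transitivity (\sum_(0 <= n < L) \sum_(pi <- bounded_overpartitions M N
    | (n < L)%N && (weight pi == n)) (w pi)%:R * y ^+ weight pi).
  apply: eq_big_nat => n /andP[_ nL].
  rewrite (overpartition_sumE _ (ltnW (leq_trans nL LM)) (ltnW (leq_trans nL LN))).
  by rewrite nL natr_sum mulr_suml; apply: eq_bigr => pi /eqP ->.
rewrite (exchange_big_dep (fun pi => weight pi < L)%N); last first.
  by move=> n pi _ /andP[nL /eqP ->].
apply: eq_bigr => pi piL; under eq_bigl do rewrite /= eq_sym.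
by rewrite big_nat1_cond_eq /= piL.
Qed.

Lemma big_uniq_subset (V : Type) (idx : V) (op : Monoid.com_law idx) (T : eqType)
    (s s' : seq T) (F : T -> V) :
    uniq s -> uniq s' -> {subset s <= s'} ->
  \big[op/idx]_(x <- s) F x = \big[op/idx]_(x <- s' | x \in s) F x.
Proof.
move=> s_uniq s'_uniq ss'; rewrite -[RHS]big_filter; apply: perm_big.
apply: uniq_perm => [||x]; rewrite ?filter_uniq // mem_filter andb_idr //.
exact: ss'.
Qed.

Lemma ler_sum_subset (K : numDomainType) (T : eqType) (s s' : seq T) (F : T -> K) :
    uniq s -> uniq s' -> {subset s <= s'} -> (forall x, 0 <= F x) ->
  \sum_(x <- s) F x <= \sum_(x <- s') F x.
Proof.
move=> s_uniq s'_uniq ss' F0; rewrite (big_uniq_subset _ _ s_uniq s'_uniq ss').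
by rewrite big_mkcond ler_sum // => x _; case: ifP.
Qed.

Lemma normr_bounded_gfB (K : numDomainType) w L M N (y : K) :
    (L <= M)%N -> (L <= N)%N ->
  `|bounded_gf w M N y - partial_gf w L y| <=
  bounded_gf w M N `|y| - partial_gf w L `|y|.
Proof.
move=> LM LN.
have diffE (z : K) : bounded_gf w M N z - partial_gf w L z =
    \sum_(pi <- bounded_overpartitions M N | ~~ (weight pi < L)%N)
      (w pi)%:R * z ^+ weight pi.
  rewrite (partial_gfE w z LM LN) /bounded_gf.
  by rewrite [X in X - _](bigID (fun pi => weight pi < L)%N) addrC addKr.
rewrite !diffE; apply: le_trans (ler_norm_sum _ _ _) _.
by apply: ler_sum => pi _; rewrite normrM normr_nat normrX.
Qed.

Lemma partial_gf_le_bounded_gf (K : numDomainType) w L M N (x : K) :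
  0 <= x -> (L <= M)%N -> (L <= N)%N -> partial_gf w L x <= bounded_gf w M N x.
Proof.
move=> x0 LM LN; rewrite -subr_ge0 -(ger0_norm x0).
exact: le_trans (normr_bounded_gfB w x LM LN).
Qed.

Lemma bounded_gf_le_partial_gf (K : numDomainType) w M N (x : K) : 0 <= x ->
  exists L, bounded_gf w M N x <= partial_gf w L x.
Proof.
move=> x0; pose W := (\sum_(pi <- bounded_overpartitions M N) weight pi)%N.
exists (M + N + W).+1; rewrite (partial_gfE _ _ (leqnn _) (leqnn _)) -big_filter.
apply: ler_sum_subset => [||pi piMN|pi].
- exact: uniq_bounded_overpartitions.
- by rewrite filter_uniq ?uniq_bounded_overpartitions.
- rewrite mem_filter ltnS (@bounded_overpartitions_sub M _ N) ?andbT //; try lia.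
  by apply: leq_trans (leq_addl _ _); rewrite /W (big_rem pi) // leq_addr.
- by rewrite mulr_ge0 ?exprn_ge0.
Qed.

Lemma sum_multiplicities (V : nmodType) M (f : nat -> V) :
  \sum_(c <- multiplicities M) f c.1 =
  \sum_(0 <= m < M.+1) f m + \sum_(1 <= m < M.+1) f m.
Proof. by rewrite big_cat !big_map. Qed.

Lemma sum_prod_num_parts (K : comPzSemiRingType) M N (phi : nat -> nat -> K) :
  \sum_(pi <- bounded_overpartitions M N)
    \prod_(1 <= t < N.+1) phi t (num_parts t pi) =
  \prod_(1 <= t < N.+1) \sum_(c <- multiplicities M) phi t c.1.
Proof.
elim: N => [|N IH]; first by rewrite big_seq1 !big_nil.
rewrite [LHS]big_allpairs_dep [RHS]big_nat_recr //= -IH.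
rewrite big_distrlr /= [RHS]exchange_big /=.
apply: eq_bigr => c _; apply: eq_big_seq => pi /bounded_overpartitionsP[_ pi_le _].
rewrite big_nat_recr //= num_parts_cat_block eqxx mul1n.
rewrite (num_parts_eq0 pi_le) // addn0; congr (_ * _).
by apply: eq_big_nat => t /andP[_ tN]; rewrite num_parts_cat_block gtn_eqF.
Qed.

Lemma weightE N pi : parts_le N pi ->
  weight pi = (\sum_(1 <= t < N.+1) t * num_parts t pi)%N.
Proof.
elim: pi => [_|p pi IH]; first by rewrite big1 // => t _; rewrite muln0.
rewrite /parts_le /= => /andP[pN /IH pi_weight].
have num_cons t : num_parts t (p :: pi) = ((p.1 == t) + num_parts t pi)%N by [].
rewrite [LHS](_ : _ = p.1 + weight pi)%N // pi_weight.
under [RHS]eq_bigr do rewrite num_cons mulnDr.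
rewrite big_split /=; congr addn.
under eq_bigr do rewrite eq_sym mulnbr.
rewrite -big_mkcond big_nat1_eq ltnS pN andbT.
by case: p.1.
Qed.

Definition repeated (r : nat) (s : seq nat) (pi : seq part) : bool :=
  all (fun t => r <= num_parts t pi)%N s.

Definition block_gf (K : pzSemiRingType) (M m : nat) (z : K) : K :=
  \sum_(c <- multiplicities M | (m <= c.1)%N) z ^+ c.1.

Lemma bounded_gf_repeated (K : comPzSemiRingType) r s M N (y : K) :
    {subset s <= index_iota 1 N.+1} ->
  bounded_gf (fun pi => repeated r s pi) M N y =
  \prod_(1 <= t < N.+1) block_gf M (if t \in s then r else 0) (y ^+ t).
Proof.
move=> sN; pose m t := if t \in s then r else 0%N.
under [RHS]eq_bigr do rewrite /block_gf big_mkcond /=.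
rewrite -(sum_prod_num_parts M N
  (fun t k => if (m t <= k)%N then (y ^+ t) ^+ k else 0)).
apply: eq_big_seq => pi /bounded_overpartitionsP[_ pi_le _].
rewrite (weightE pi_le) expr_sum; case: (boolP (repeated r s pi)) => [/allP rep|].
  rewrite mul1r; apply: eq_bigr => t _; rewrite -exprM /m.
  by case: (boolP (t \in s)) => // ts; rewrite rep.
case/allPn => t ts lt_r; rewrite mul0r (bigD1_seq t) ?sN ?iota_uniq //=.
by rewrite /m ts (negbTE lt_r) mul0r.
Qed.

(** * The minimal excludant as a count of repeated progressions *)

Definition progression (A a k : nat) : seq nat := mkseq (fun j => a + j * A)%N k.

Lemma mem_progression A a k t :
  reflect (exists2 j, (j < k)%N & t = (a + j * A)%N) (t \in progression A a k).
Proof. by apply: (iffP mapP) => -[j jk ->]; exists j; rewrite ?mem_iota // in jk *. Qed.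

Lemma uniq_progression A a k : (0 < A)%N -> uniq (progression A a k).
Proof.
by move=> A0; apply: mkseq_uniq => i j /addnI/eqP; rewrite eqn_pmul2r // => /eqP.
Qed.

Lemma progression_sub A a k N : (0 < a)%N -> (a + k.-1 * A <= N)%N ->
  {subset progression A a k <= index_iota 1 N.+1}.
Proof.
move=> a0 kN t /mem_progression[j jk ->]; rewrite mem_index_iota ltnS.
rewrite addn_gt0 a0 (leq_trans _ kN) // leq_add2l leq_mul2r; apply/orP; right.
by rewrite -ltnS (ltn_predK jk).
Qed.

Lemma mes_candidateP r A a pi m : (1 <= a <= A)%N ->
  reflect (exists2 j, m = (a + j * A)%N & (num_parts m pi < r)%N)
          (mes_candidate r A a pi m).
Proof.
move=> /andP[a0 aA]; apply: (iffP and3P) => [[m0 mA few]|[j -> few]]; last first.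
  by split; rewrite // ?addn_gt0 ?a0 // addnC modnMDl.
have am : (a <= m)%N.
  rewrite leqNgt; apply/negP => ma; move: mA.
  rewrite modn_small ?(leq_trans ma) //.
  have [<-|aA'] := eqVneq a A; first by rewrite modnn gtn_eqF.
  by rewrite modn_small ?ltn_eqF // ltn_neqAle aA'.
exists ((m - a) %/ A)%N => //; rewrite divnK ?subnKC //.
by rewrite -eqn_mod_dvd.
Qed.

Section MesIndex.
Variables (r A a : nat) (pi : seq part).
Hypotheses (aA : (1 <= a <= A)%N) (r0 : (0 < r)%N).

Let A0 : (0 < A)%N. Proof. by case/andP: aA; apply: leq_trans. Qed.

Lemma mes_index : exists j, [/\ mes r A a pi = (a + j * A)%N,
  (num_parts (a + j * A) pi < r)%N
  & forall i, (i < j)%N -> (r <= num_parts (a + i * A) pi)%N].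
Proof.
have [/(mes_candidateP _ _ _ aA)[j mesE few] mes_min] := mesP a pi A0 r0.
exists j; split => [//||i ij]; first by rewrite -mesE.
rewrite leqNgt; apply/negP => few_i.
have /mes_min : mes_candidate r A a pi (a + i * A).
  by apply/mes_candidateP => //; exists i.
by rewrite mesE leq_add2l leq_pmul2r // leqNgt ij.
Qed.

Lemma mes_progression L : parts_le (a + L * A) pi ->
  mes r A a pi = (a + A * \sum_(1 <= k < L.+2) repeated r (progression A a k) pi)%N.
Proof.
move=> pi_le; have [j [-> few many]] := mes_index.
have repeatedE k : repeated r (progression A a k) pi = (k <= j)%N.
  apply/allP/idP => [rep|kj t /mem_progression[i ik ->]]; last first.
    exact/many/(leq_trans ik).
  rewrite leqNgt; apply/negP => jk; move: few; rewrite ltnNge rep //.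
  by apply/mem_progression; exists j.
have jL : (j < L.+2)%N.
  rewrite ltnS leqNgt; apply/negP => Lj; move: (many _ Lj).
  by rewrite (num_parts_eq0 pi_le) ?ltn_add2l ?ltn_pmul2r // leqNgt r0.
rewrite mulnC; congr (_ + A * _)%N.
have {1}<- : (\sum_(1 <= k < j.+1) 1 = j)%N by rewrite sum_nat_const_nat muln1 subn1.
rewrite (big_nat_widen _ _ L.+2) // big_mkcond; apply: eq_bigr => k _.
by rewrite repeatedE ltnS /=; case: leq.
Qed.

End MesIndex.

Lemma bounded_gf_mes (K : comPzSemiRingType) r A a M L (y : K) :
    (1 <= a <= A)%N -> (0 < r)%N ->
  bounded_gf (mes r A a) M (a + L * A) y =
  a%:R * bounded_gf (fun pi => repeated r [::] pi) M (a + L * A) y +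
  A%:R * \sum_(1 <= k < L.+2)
    bounded_gf (fun pi => repeated r (progression A a k) pi) M (a + L * A) y.
Proof.
move=> aA r0; rewrite /bounded_gf exchange_big /= !mulr_sumr -big_split /=.
apply: eq_big_seq => pi /bounded_overpartitionsP[_ pi_le _].
rewrite (mes_progression aA r0 pi_le) natrD natrM natr_sum mul1r mulrDl -mulrA.
by rewrite mulr_suml.
Qed.

(** * Closed forms of the local factors *)

(* The two geometric series count the blocks without and with an overlined part. *)
Definition block_gf_lim (K : unitRingType) (m : nat) (z : K) : K :=
  (z ^+ m + z ^+ maxn 1 m) / (1 - z).

Lemma sum_exprn_nat (K : numFieldType) m n (z : K) : z != 1 -> (m <= n)%N ->
  \sum_(m <= i < n) z ^+ i = (z ^+ m - z ^+ n) / (1 - z).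
Proof.
move=> z1 mn; rewrite -(subnKC mn) geometric_partial_tail geometric_seriesE //=.
by rewrite mulrBr mulr1 -exprD.
Qed.

Lemma block_gfE (K : numFieldType) M m (z : K) : z != 1 -> (m <= M.+1)%N ->
  block_gf M m z = block_gf_lim m z - 2 * z ^+ M.+1 / (1 - z).
Proof.
move=> z1 mM; rewrite /block_gf big_mkcond /=.
rewrite (sum_multiplicities M (fun k => if (m <= k)%N then z ^+ k else 0)).
have from_m p : \sum_(p <= k < M.+1) (if (m <= k)%N then z ^+ k else 0) =
    \sum_(maxn p m <= k < M.+1) z ^+ k.
  rewrite -big_mkcond (big_nat_widenl _ _ _ _ _ (leq_maxl p m)).
  rewrite big_nat_cond [RHS]big_nat_cond; apply: eq_bigl => k.
  by rewrite geq_max; case: (p <= k)%N.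
rewrite !from_m !sum_exprn_nat ?geq_max ?mM // max0n -mulrDl -mulrBl.
by congr (_ / _); ring.
Qed.

Lemma prod_block_gf_lim (K : fieldType) r s N (y : K) : (0 < r)%N ->
    uniq s -> {subset s <= index_iota 1 N.+1} ->
    (forall t, t \in s -> 1 + y ^+ t != 0) ->
  \prod_(1 <= t < N.+1) block_gf_lim (if t \in s then r else 0) (y ^+ t) =
  \prod_(1 <= t < N.+1) ((1 + y ^+ t) / (1 - y ^+ t)) *
  \prod_(t <- s) (2 * y ^+ (t * r) / (1 + y ^+ t)).
Proof.
move=> r0 s_uniq sN yD.
rewrite (big_uniq_subset _ _ s_uniq (iota_uniq _ _) sN).
rewrite [X in _ = _ * X]big_mkcond -big_split /=.
apply: eq_bigr => t _; rewrite /block_gf_lim exprM; case: ifPn => [/yD yt|_].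
  by rewrite (maxn_idPr r0); set d := (1 - _)^-1; field.
by rewrite expr0 expr1 mulr1.
Qed.

Definition qprod (K : pzRingType) (x q : K) (n : nat) : K :=
  \prod_(0 <= i < n) (1 - x * q ^+ i).

Lemma qprodS (K : pzRingType) (x q : K) n :
  qprod x q n.+1 = qprod x q n * (1 - x * q ^+ n).
Proof. by rewrite /qprod big_nat_recr. Qed.

Lemma qprodD (K : pzRingType) (x q : K) m n :
  qprod x q (m + n) = qprod x q m * qprod (x * q ^+ m) q n.
Proof.
rewrite /qprod (big_cat_nat (n := m)) ?leq_addr //=; congr (_ * _).
rewrite -{1}[m]add0n big_addn addKn; apply: eq_bigr => i _.
by rewrite addnC exprD mulrA.
Qed.

Lemma prod_qprod_ratio (K : fieldType) N (y : K) :
  \prod_(1 <= t < N.+1) ((1 + y ^+ t) / (1 - y ^+ t)) = qprod (- y) y N / qprod y y N.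
Proof.
rewrite big_add1 -prodf_div; apply: eq_bigr => i _.
by rewrite mulNr opprK -exprS.
Qed.

Lemma prod_progression (K : fieldType) r A a k (y : K) :
  \prod_(t <- progression A a k) (2 * y ^+ (t * r) / (1 + y ^+ t)) =
  2 ^+ k * y ^+ (r * (A * 'C(k, 2) + k * a)) / qprod (- y ^+ a) (y ^+ A) k.
Proof.
elim: k => [|k IH]; first by rewrite big_nil /qprod big_nil !muln0 invr1 !mulr1.
rewrite /progression mkseqS big_rcons IH qprodS invfM mulNr opprK -exprM -exprD /=.
have -> : (r * (A * 'C(k.+1, 2) + k.+1 * a) =
          r * (A * 'C(k, 2) + k * a) + (a + k * A) * r)%N by rewrite binS bin1; ring.
by rewrite [y ^+ (r * _ + _)]exprD exprSr [(A * k)%N]mulnC; ring.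
Qed.

(** * Series and infinite products *)

Lemma ratio_test (R : realType) (u : R^nat) (x : R) : 0 <= x < 1 ->
    (forall n, 0 <= u n) -> (\forall n \near \oo, u n.+1 <= x * u n) ->
  cvgn (series u).
Proof.
move=> /andP[x0 x1] u0 [N _ u_ratio]; rewrite -(is_cvg_series_restrict N).
have u_le k : u (k + N)%N <= u N * x ^+ k.
  elim: k => [|k IH]; first by rewrite mulr1.
  apply: le_trans (u_ratio _ (leq_addl k N)) _.
  by rewrite exprS mulrCA ler_wpM2l.
have : cvgn (series (fun k => u (k + N)%N)).
  apply: series_le_cvg u_le _ => [//|k|]; first by rewrite mulr_ge0 ?exprn_ge0.
  by apply: is_cvg_geometric_series; rewrite ger0_norm.
move=> /cvg_ex[l u_l]; apply/cvg_ex; exists l; rewrite -(cvg_shiftn N).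
by under eq_cvg do rewrite /= -{1}[N]add0n big_addn addnK.
Qed.

Lemma cvg_series_theta (R : realType) (c x : R) : 0 <= c -> 0 <= x < 1 ->
  cvgn (series (fun k => c ^+ k * x ^+ 'C(k, 2))).
Proof.
move=> c0 /andP[x0 x1]; apply: (@ratio_test _ _ 2^-1) => [|n|].
- by rewrite invr_ge0 ler0n invf_lt1 // ltr1n.
- by rewrite mulr_ge0 ?exprn_ge0.
have /cvgrPdist_lt/(_ 2^-1) : c * x ^+ n @[n --> \oo] --> (0 : R).
  by rewrite -(mulr0 c); apply: cvgMl_tmp; apply: cvg_expr; rewrite ger0_norm.
rewrite invr_gt0 => /(_ (ltr0n _ 2)); apply: filterS => n.
rewrite sub0r normrN ger0_norm ?mulr_ge0 ?exprn_ge0 // => /ltW cx.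
rewrite binS bin1 exprS exprD [leLHS](_ : _ = c * x ^+ n * (c ^+ n * x ^+ 'C(n, 2))).
  by rewrite ler_wpM2r ?mulr_ge0 ?exprn_ge0.
by ring.
Qed.

Section ComplexSequences.
Local Open Scope complex_scope.
Variable R : realType.
Implicit Types (u : nat -> complexes R) (l z : complexes R).

Lemma normr_normc z : `|z| = (normc z)%:C :> R[i].
Proof. by []. Qed.

Lemma normc_ge0 z : 0 <= normc z.
Proof. by rewrite -lecR -normr_normc normr_ge0. Qed.

Lemma normc_real (x : R) : normc (x%:C : complexes R) = `|x|.
Proof. by rewrite /= expr0n addr0 sqrtr_sqr. Qed.

Lemma normcX z n : normc (z ^+ n) = normc z ^+ n.
Proof. by elim: n => [|n IH]; rewrite ?expr0 ?normc1 // !exprS normcM IH. Qed.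

Lemma distcC z l : normc (z - l) = normc (l - z).
Proof. by rewrite -normcN opprB. Qed.

Lemma normc_nat n : normc (n%:R : complexes R) = n%:R.
Proof. by rewrite normcMn normc1. Qed.

Lemma normc_prod (F : nat -> complexes R) n :
  normc (\prod_(0 <= i < n) F i) = \prod_(0 <= i < n) normc (F i).
Proof. by apply: (big_morph (@normc R) (@normcM R)); rewrite normc1. Qed.

Lemma lerB_normcD z l : normc z - normc l <= normc (z + l).
Proof. by rewrite lerBlDr -[z in leLHS](addrK l) -(normcN l) le_normcD. Qed.

Lemma Re_le_normc z : `|complex.Re z| <= normc z.
Proof. by rewrite -lecR -normr_normc normc_ge_Re. Qed.

Lemma Im_le_normc z : `|complex.Im z| <= normc z.
Proof. by case: z => x y /=; rewrite -sqrtr_sqr ler_wsqrtr // lerDr sqr_ge0. Qed.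

Lemma normc_le_ReIm z : normc z <= `|complex.Re z| + `|complex.Im z|.
Proof.
case: z => x y /=; rewrite -[leRHS]ger0_norm ?addr_ge0 // -sqrtr_sqr ler_wsqrtr //.
rewrite [leRHS]sqrrD !real_normK ?num_real // [leRHS]addrAC lerDl.
by rewrite mulrn_wge0 ?mulr_ge0.
Qed.

Lemma cvg_normcP u l : u @ \oo --> l <-> normc (u n - l) @[n --> \oo] --> (0 : R).
Proof.
have distE n (e : R) :
    (`|l - u n| < (e%:C : complexes R)) = (`|0 - normc (u n - l)| < e).
  by rewrite sub0r normrN [in RHS]ger0_norm ?normc_ge0 // distcC; exact: ltcR.
split=> /cvgrPdist_lt u_l; apply/cvgrPdist_lt => e e0.
  have /u_l : 0 < (e%:C : complexes R) by rewrite ltcR.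
  by apply: filterS => n; rewrite distE.
have [d ed] : exists d : R, e = d%:C by apply/complex_realP; rewrite gtr0_real.
move: e0; rewrite ed ltcR => /u_l.
by apply: filterS => n; rewrite distE.
Qed.

Lemma squeeze_cvg_normc u l (b : nat -> R) :
  (forall n, normc (u n - l) <= b n) -> b @ \oo --> (0 : R) -> u @ \oo --> l.
Proof.
move=> ub b0; apply/cvg_normcP; apply: (squeeze_cvgr _ (cvg_cst 0) b0).
by apply: nearW => n; rewrite normc_ge0 ub.
Qed.

Lemma cvg_normc u l : u @ \oo --> l -> normc (u n) @[n --> \oo] --> normc l.
Proof.
move=> /cvg_normcP u_l; apply/subr_cvg0/norm_cvg0P.
apply: (squeeze_cvgr _ (cvg_cst 0) u_l); apply: nearW => n; rewrite normr_ge0 /=.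
rewrite ler_norml lerNl opprB; apply/andP; split.
  by rewrite distcC -(normcN (u n)) lerB_normcD.
by rewrite -(normcN l) lerB_normcD.
Qed.

Lemma cvgn_normc_bounded u : cvgn u -> exists B, forall n, normc (u n) <= B.
Proof.
move=> /cvg_normc/cvgP/cvg_seq_bounded/bounded_fun_has_ubound[B ubB].
by exists B => n; apply: ubB; exists n.
Qed.

Lemma cvg_ReIm u (x y : R) :
    complex.Re (u n) @[n --> \oo] --> x -> complex.Im (u n) @[n --> \oo] --> y ->
  u @ \oo --> (x +i* y : complexes R).
Proof.
move=> u_x u_y; pose d n := `|complex.Re (u n) - x| + `|complex.Im (u n) - y|.
apply: (@squeeze_cvg_normc _ _ d) => [n|]; last first.
  by rewrite -[0]addr0; apply: cvgD; apply/norm_cvg0P/subr_cvg0.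
by apply: le_trans (normc_le_ReIm _) _; rewrite /d; case: (u n).
Qed.

Lemma normc_series_cvg u (b : nat -> R) :
  (forall n, normc (u n) <= b n) -> cvgn (series b) -> cvgn (series u).
Proof.
move=> ub cb.
have cvg_component (f : complexes R -> R) : {morph f : z l / z + l} -> f 0 = 0 ->
    (forall z, `|f z| <= normc z) -> cvgn (f \o series u).
  move=> fD f0 f_le; rewrite (_ : f \o _ = series (f \o u)); last first.
    by apply/funext => n; rewrite /series /= (big_morph f fD f0).
  apply: normed_cvg; apply: series_le_cvg cb => n //=; last exact: le_trans (ub n).
  exact: le_trans (normc_ge0 _) (ub n).
have /cvg_ex[x cx] : cvgn (fun n => complex.Re (series u n)).
  by apply: cvg_component Re_le_normc => // -[? ?] [? ?].
have /cvg_ex[y cy] : cvgn (fun n => complex.Im (series u n)).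
  by apply: cvg_component Im_le_normc => // -[? ?] [? ?].
exact: cvgP (cvg_ReIm cx cy).
Qed.

Lemma cvg_exprc z : normc z < 1 -> z ^+ n @[n --> \oo] --> (0 : complexes R).
Proof.
move=> z1; apply: (@squeeze_cvg_normc _ _ (fun n => normc z ^+ n)) => [n|].
  by rewrite subr0 normcX.
by apply: cvg_expr; rewrite ger0_norm ?normc_ge0.
Qed.

Lemma normc_exprn_lt1 z n : normc z < 1 -> (0 < n)%N -> normc (z ^+ n) < 1.
Proof. by move=> z1 n0; rewrite normcX exprn_ilt1 ?normc_ge0 -?lt0n. Qed.

Lemma normc_lt1_add1_neq0 z : normc z < 1 -> 1 + z != 0.
Proof.
apply: contraTneq => /eqP; rewrite addrC addr_eq0 => /eqP ->.
by rewrite normcN normc1 ltxx.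
Qed.

End ComplexSequences.

Definition abs_summable (R : realType) (u : nat -> complexes R) : Prop :=
  cvgn (series (fun n => normc (u n))).

Lemma cvg_prod1D (R : realType) (u : nat -> complexes R) :
  abs_summable u -> cvgn (fun n => \prod_(0 <= i < n) (1 + u i)).
Proof.
move=> u_summable; pose P n := \prod_(0 <= i < n) (1 + u i).
pose total := limn (series (fun n => normc (u n))).
have P_le n : normc (P n) <= expR total.
  rewrite /P normc_prod.
  apply: (@le_trans _ _ (expR (series (fun n => normc (u n)) n))).
    rewrite expR_sum; apply: ler_prod => i _; rewrite normc_ge0 /=.
    by apply: le_trans (expR_ge1Dx _); rewrite -[1 in leRHS](normc1 R) le_normcD.
  rewrite ler_expR; apply: nondecreasing_cvgn_le u_summable n.
  by apply: nondecreasing_series => i _ _; apply: normc_ge0.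
rewrite (_ : (fun n => _) = fun n => P 0%N + series (telescope P) n); last first.
  by apply/funext => n; rewrite -eq_sum_telescope.
apply: is_cvgD; first exact: is_cvg_cst.
apply: (@normc_series_cvg _ _ (expR total *: (fun n => normc (u n)))) => [n|].
  rewrite /telescope /= {1}/P big_nat_recr //= mulrDr mulr1 addrC addKr normcM.
  by rewrite ler_wpM2r ?normc_ge0 ?P_le.
exact: is_cvg_seriesZ.
Qed.

Section NonvanishingProducts.
Variables (R : realType) (u : nat -> complexes R) (c : R).
Hypotheses (c1 : c < 1) (u_le : forall n, normc (u n) <= c).
Hypothesis u_summable : abs_summable u.

Let factor_neq0 n : 1 + u n != 0.
Proof. exact: normc_lt1_add1_neq0 (le_lt_trans (u_le n) c1). Qed.

Lemma cvg_inv_prod1D : cvgn (fun n => (\prod_(0 <= i < n) (1 + u i))^-1).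
Proof.
rewrite (_ : (fun n => _) = fun n => \prod_(0 <= i < n) (1 + - (u i / (1 + u i)))).
  apply: cvg_prod1D.
  apply: (@series_le_cvg _ _ ((1 - c)^-1 *: (fun n => normc (u n)))) => [n|n|n|].
  - exact: normc_ge0.
  - by rewrite mulr_ge0 ?normc_ge0 // invr_ge0 subr_ge0 ltW.
  - rewrite [leRHS]mulrC /= normcN normcM ler_wpM2l ?normc_ge0 // normcV.
    have le_factor : 1 - c <= normc (1 + u n).
      by apply: le_trans (lerB_normcD _ _); rewrite normc1 lerB.
    by rewrite lef_pV2 ?posrE ?(lt_le_trans _ le_factor) ?subr_gt0.
  - exact: is_cvg_seriesZ.
apply/funext => n; rewrite -prodfV; apply: eq_bigr => i _.
by apply: (mulfI (factor_neq0 i)); field.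
Qed.

Lemma limn_prod1D_neq0 : limn (fun n => \prod_(0 <= i < n) (1 + u i)) != 0.
Proof.
pose P n := \prod_(0 <= i < n) (1 + u i).
have cvg_PV : P n / P n @[n --> \oo] --> limn P * limn (fun n => (P n)^-1).
  exact: cvgM (cvg_prod1D u_summable) cvg_inv_prod1D.
have PV n : P n / P n = 1.
  by rewrite mulfV // prodf_seq_neq0; apply/allP => i _; rewrite factor_neq0.
apply: contra_neq (oner_neq0 (complexes R)) => P0.
move: cvg_PV; rewrite -/P P0 mul0r; under eq_cvg do rewrite PV.
by move=> /cvg_lim <- //; rewrite lim_cst.
Qed.

End NonvanishingProducts.

Section QPochhammer.
Variables (R : realType) (q : complexes R).
Hypothesis q1 : normc q < 1.
Implicit Types x : complexes R.

Lemma normc_mul_exprn_le x n : normc (x * q ^+ n) <= normc x.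
Proof.
by rewrite normcM normcX ler_piMr ?normc_ge0 // exprn_ile1 ?normc_ge0 ?ltW.
Qed.

Let u x (i : nat) : complexes R := - (x * q ^+ i).

Let u_summable x : abs_summable (u x).
Proof.
rewrite /abs_summable (_ : (fun i => _) = geometric (normc x) (normc q)).
  by apply: is_cvg_geometric_series; rewrite ger0_norm ?normc_ge0.
by apply/funext => i; rewrite /= normcN normcM normcX.
Qed.

Let u_le x n : normc (u x n) <= normc x.
Proof. by rewrite normcN normc_mul_exprn_le. Qed.

Lemma cvg_qprod x : qprod x q @ \oo --> qpoch_inf x q.
Proof. exact: cvg_prod1D (@u_summable x). Qed.

Lemma cvg_inv_qprod x : normc x < 1 -> cvgn (fun n => (qprod x q n)^-1).
Proof. by move=> x1; exact: cvg_inv_prod1D x1 (u_le x) (@u_summable x). Qed.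

Lemma qpoch_inf_neq0 x : normc x < 1 -> qpoch_inf x q != 0.
Proof. by move=> x1; exact: limn_prod1D_neq0 x1 (u_le x) (@u_summable x). Qed.

Lemma qpoch_inf_split x n : qpoch_inf x q = qprod x q n * qpoch_inf (x * q ^+ n) q.
Proof.
apply/cvg_lim => //; rewrite -(cvg_shiftn n) /=.
under eq_cvg do rewrite -/(qprod x q _) addnC qprodD.
by apply: cvgMl_tmp; exact: cvg_qprod.
Qed.

Lemma qpochE x n : normc x < 1 -> qpoch x q n = qprod x q n.
Proof.
move=> x1; rewrite /qpoch (qpoch_inf_split x n) mulfK // qpoch_inf_neq0 //.
exact: le_lt_trans (normc_mul_exprn_le x n) x1.
Qed.

End QPochhammer.

(** * Dominated passage to the limit *)

Lemma normc_bounded_gfB (R : realType) w L M N (q : complexes R) :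
    (L <= M)%N -> (L <= N)%N ->
  normc (bounded_gf w M N q - partial_gf w L q) <=
  bounded_gf w M N (normc q) - partial_gf w L (normc q).
Proof.
move=> LM LN; rewrite -lecR rmorphB /= rmorph_bounded_gf rmorph_partial_gf.
exact: normr_bounded_gfB.
Qed.

Section DominatedLimit.
Variables (R : realType) (w : seq part -> nat) (N : nat -> nat).
Variables (F : complexes R -> nat -> complexes R) (q : complexes R).
Hypothesis le_N : forall L, (L <= N L)%N.
Hypothesis cvg_bounded_gf : forall y L, normc y = normc q ->
  bounded_gf w M (N L) y @[M --> \oo] --> F y L.
Hypothesis is_cvg_F : forall y, normc y = normc q -> cvgn (F y).

Let majorant L : R := partial_gf w L (normc q).

Let majorant_nondecreasing : nondecreasing_seq majorant.
Proof.
by apply: nondecreasing_series => n _ _; rewrite mulr_ge0 ?exprn_ge0 ?normc_ge0.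
Qed.

Lemma is_cvg_partial_gf_normc : cvgn majorant.
Proof.
pose x : complexes R := (normc q)%:C%C.
have x_normc : normc x = normc q by rewrite normc_real ger0_norm ?normc_ge0.
have [B F_le] := cvgn_normc_bounded (is_cvg_F x_normc).
apply: nondecreasing_is_cvgn majorant_nondecreasing _; exists B => _ [L _ <-].
have cvg_x : bounded_gf w M (N L) x @[M --> \oo] --> F x L by exact: cvg_bounded_gf.
apply: le_trans (F_le L); apply: cvgr_to_ge (cvg_normc cvg_x) _.
exists L => // M /= LM; rewrite -rmorph_bounded_gf normc_real.
apply: le_trans (ler_norm _).
exact: partial_gf_le_bounded_gf (normc_ge0 q) LM (le_N L).
Qed.

Lemma normc_partial_gfB L :
  normc (partial_gf w L q - F q L) <= limn majorant - majorant L.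
Proof.
rewrite distcC.
have cvg_dist : normc (bounded_gf w M (N L) q - partial_gf w L q) @[M --> \oo] -->
    normc (F q L - partial_gf w L q).
  by apply: cvg_normc; apply: cvgB; [exact: cvg_bounded_gf | exact: cvg_cst].
apply: cvgr_to_le cvg_dist _; exists L => // M /= LM.
apply: le_trans (normc_bounded_gfB w q LM (le_N L)) _; rewrite lerD2r.
have [B] := bounded_gf_le_partial_gf w M (N L) (normc_ge0 q).
move=> /le_trans; apply; apply: nondecreasing_cvgn_le => //.
exact: is_cvg_partial_gf_normc.
Qed.

Lemma cvg_partial_gf : partial_gf w ^~ q @ \oo --> limn (F q).
Proof.
have cvg_diff : partial_gf w L q - F q L @[L --> \oo] --> (0 : complexes R).
  apply: (@squeeze_cvg_normc _ _ _ (fun L => limn majorant - majorant L)) => [L|].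
    by rewrite subr0 normc_partial_gfB.
  by rewrite -(subrr (limn majorant)); apply: cvgB (cvg_cst _) is_cvg_partial_gf_normc.
have -> : partial_gf w ^~ q = fun L => (partial_gf w L q - F q L) + F q L.
  by apply/funext => L; rewrite subrK.
rewrite -[X in _ --> X]add0r; apply: cvgD cvg_diff _.
exact: is_cvg_F.
Qed.

End DominatedLimit.

(** * The series for the minimal excludant *)

Lemma cvg_block_gf (R : realType) m (z : complexes R) : normc z < 1 ->
  block_gf M m z @[M --> \oo] --> block_gf_lim m z.
Proof.
move=> z1; have z_neq1 : z != 1.
  by rewrite eq_sym -subr_eq0 normc_lt1_add1_neq0 ?normcN.
have cvg_remainder : 2 * z ^+ M.+1 / (1 - z) @[M --> \oo] --> (0 : complexes R).
  rewrite -[X in _ --> X](mul0r (1 - z)^-1) -[X in X * _](mulr0 2).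
  apply: cvgMr_tmp; apply: cvgMl_tmp.
  by rewrite (cvg_shiftS (fun M => z ^+ M)); apply: cvg_exprc.
have : block_gf_lim m z - 2 * z ^+ M.+1 / (1 - z) @[M --> \oo] --> block_gf_lim m z.
  by rewrite -[X in _ --> X]subr0; apply: cvgB cvg_remainder; apply: cvg_cst.
apply: cvg_trans; apply: near_eq_cvg; exists m => // M /= mM.
by rewrite block_gfE // leqW.
Qed.

Lemma cvg_bounded_gf_repeated (R : realType) r s N (y : complexes R) :
    (0 < r)%N -> uniq s -> {subset s <= index_iota 1 N.+1} -> normc y < 1 ->
  bounded_gf (fun pi => repeated r s pi) M N y @[M --> \oo] -->
  qprod (- y) y N / qprod y y N * \prod_(t <- s) (2 * y ^+ (t * r) / (1 + y ^+ t)).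
Proof.
move=> r0 s_uniq sN y1.
rewrite -prod_qprod_ratio -prod_block_gf_lim // => [|t /sN]; last first.
  rewrite mem_index_iota => /andP[t0 _].
  exact/normc_lt1_add1_neq0/normc_exprn_lt1.
rewrite big_nat; under eq_cvg do rewrite bounded_gf_repeated // big_nat.
apply: cvg_big => [|t /andP[t0 _]].
  exact: mul_continuous.
exact/cvg_block_gf/normc_exprn_lt1.
Qed.

Section MesSeries.
Variables (R : realType) (r A a : nat).
Hypotheses (aA : (1 <= a <= A)%N) (r0 : (0 < r)%N).
Implicit Types y : complexes R.

Let a0 : (0 < a)%N. Proof. by case/andP: aA. Qed.
Let A0 : (0 < A)%N. Proof. by case/andP: aA; apply: leq_trans. Qed.

Definition mes_term y (k : nat) : complexes R :=
  2 ^+ k * y ^+ (r * (A * 'C(k, 2) + k * a)) / qpoch (- y ^+ a) (y ^+ A) k.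

(* The generating function of [mes] over overpartitions with parts at most
   [a + L * A]. *)
Definition mes_gf_parts_le y (L : nat) : complexes R :=
  qprod (- y) y (a + L * A) / qprod y y (a + L * A) *
  (a%:R + A%:R * \sum_(1 <= k < L.+2) mes_term y k).

Lemma mes_termE y k : normc y < 1 ->
  mes_term y k = \prod_(t <- progression A a k) (2 * y ^+ (t * r) / (1 + y ^+ t)).
Proof.
by move=> y1; rewrite prod_progression /mes_term qpochE ?normcN ?normc_exprn_lt1.
Qed.

Lemma is_cvg_mes_series y : normc y < 1 ->
  cvgn (fun N => \sum_(1 <= k < N) mes_term y k).
Proof.
move=> y1; rewrite is_cvg_series_restrict.
have [|B inv_qprod_le] := cvgn_normc_bounded
    (@cvg_inv_qprod _ _ (normc_exprn_lt1 y1 A0) (- y ^+ a) _).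
  by rewrite normcN normc_exprn_lt1.
apply: (@normc_series_cvg _ _ (B *: (fun k => 2 ^+ k * normc y ^+ 'C(k, 2)))) => [k|].
  rewrite /mes_term qpochE ?normcN ?normc_exprn_lt1 // normcM mulrC.
  rewrite ler_pM ?normc_ge0 // normcM !normcX normc_nat ler_wpM2l ?exprn_ge0 //.
  rewrite ler_wiXn2l ?normc_ge0 ?ltW // (leq_trans _ (leq_pmull _ r0)) //.
  by rewrite (leq_trans (leq_pmull _ A0)) ?leq_addr.
by apply: is_cvg_seriesZ; apply: cvg_series_theta; rewrite ?normc_ge0.
Qed.

Lemma cvg_bounded_gf_mes y L : normc y < 1 ->
  bounded_gf (mes r A a) M (a + L * A) y @[M --> \oo] --> mes_gf_parts_le y L.
Proof.
move=> y1; under eq_cvg do rewrite bounded_gf_mes //.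
rewrite /mes_gf_parts_le mulrDr; apply: cvgD.
  rewrite mulrC; apply: cvgMl_tmp.
  have := @cvg_bounded_gf_repeated R r [::] (a + L * A) y.
  by rewrite big_nil mulr1; apply.
rewrite mulrCA; apply: cvgMl_tmp; rewrite mulr_sumr big_nat.
under eq_cvg do rewrite big_nat; apply: cvg_big => [|k /andP[_ kL]].
  exact: add_continuous.
rewrite mes_termE //; apply: cvg_bounded_gf_repeated => //.
  exact: uniq_progression.
by apply: progression_sub => //; rewrite leq_add2l leq_pmul2r // -subn1 leq_subLR.
Qed.

Lemma cvg_mes_gf_parts_le y : normc y < 1 -> mes_gf_parts_le y @ \oo -->
  qpoch_inf (- y) y / qpoch_inf y y *
  (a%:R + A%:R * limn (fun N => \sum_(1 <= k < N) mes_term y k)).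
Proof.
move=> y1.
have cvg_parts : (a + L * A)%N @[L --> \oo] --> \oo.
  move=> P [m _ mP]; exists m => // L /= mL; apply: mP => /=.
  by apply: leq_trans mL (leq_trans _ (leq_addl _ _)); rewrite leq_pmulr.
have cvg_qprod_parts x : qprod x y (a + L * A) @[L --> \oo] --> qpoch_inf x y.
  by apply: cvg_comp cvg_parts _; apply: cvg_qprod.
apply: cvgM; first by apply: cvgM => //; apply: cvgV; rewrite ?qpoch_inf_neq0.
apply: cvgD; first exact: cvg_cst.
pose partial N := \sum_(1 <= k < N) mes_term y k.
apply: cvgMl_tmp; rewrite (cvg_shiftS (fun L => partial L.+1)) (cvg_shiftS partial).
exact: is_cvg_mes_series.
Qed.

End MesSeries.

Theorem theorem2p2 (R : realType) (A a r : nat) (q : complexes R)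
    (haA : (1 <= a <= A)%N) (hr : (1 <= r)%N) (hq : `|q| < 1) :
  let lhs := fun N : nat =>
    \sum_(0 <= n < N) (sigma_mes r A a n)%:R * q ^+ n in
  let rhs := fun N : nat =>
    \sum_(1 <= k < N)
      (2 ^+ k * q ^+ (r * (A * 'C(k, 2) + k * a))) / qpoch (- q ^+ a) (q ^+ A) k in
  [/\ cvgn lhs, cvgn rhs
    & limn lhs = qpoch_inf (- q) q / qpoch_inf q q * (a%:R + A%:R * limn rhs)].
Proof.
have q1 : normc q < 1 by rewrite -ltcR.
have A0 : (0 < A)%N by case/andP: haA; apply: leq_trans.
move=> lhs rhs; have cvg_mes_gf := cvg_mes_gf_parts_le haA hr q1.
have cvg_lhs : lhs @ \oo --> limn (mes_gf_parts_le r A a q).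
  apply: (@cvg_partial_gf _ (mes r A a) (fun L => a + L * A)%N) => [L|y L y_q|y y_q].
  - by rewrite (leq_trans _ (leq_addl _ _)) ?leq_pmulr.
  - by apply: cvg_bounded_gf_mes; rewrite ?y_q.
  - by apply: cvgP; apply: cvg_mes_gf_parts_le; rewrite ?y_q.
split; first exact: cvgP cvg_lhs; first exact: is_cvg_mes_series.
by rewrite (cvg_lim _ cvg_lhs) // (cvg_lim _ cvg_mes_gf).
Qed.
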